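(* In the $1$-attribute model, the rotation poset of any stable matching instance is a chain (totally ordered set): for any two distinct rotations $R,R'$ of the instance, either $R$ precedes $R'$ or $R'$ precedes $R$.
   Context: A stable matching instance has $n$ men and $n$ women, each with a strict preference list over all members of the opposite sex; a matching is stable if it has no blocking pair (a man and woman not matched together who prefer each other to their partners). In the $1$-attribute model each person $P$ has real numbers $\hat P$ (preference) and $\bar P$ (position); man $M$ prefers $w$ to $w'$ iff $\hat M\bar w>\hat M\bar w'$, and woman $w$ prefers $M$ to $M'$ iff $\hat w\bar M>\hat w\bar M'$, with all relevant products distinct. For a stable matching $\mathcal M$, the suitor $S_{\mathcal M}(M)$ of man $M$ is the first woman $w$ on $M$'s list such that $M$ prefers his partner to $w$ and $w$ prefers $M$ to her partner in $\mathcal M$. A rotation exposed in $\mathcal M$ is a cyclically ordered list $(M_0,w_0),\dots,(M_{k-1},w_{k-1})$ of pairs of $\mathcal M$ with $S_{\mathcal M}(M_i)=w_{i+1 \bmod k}$ for all $i$; the rotations of the instance are those exposed in some stable matching. Applying it replaces each pair $(M_i,w_i)$ by $(M_i,w_{i+1})$. A pair $(M,w)$ is eliminated by rotation $R$ if $R$ moves $w$ from $M$ or a man below $M$ on her list to a man strictly above $M$. Rotation $R$ explicitly precedes $R'$ if $R$ eliminates some pair $(M,w)$ and $R'$ moves $M$ to a woman $w'$ with $M$ strictly preferring $w$ to $w'$; ''precedes'' is the transitive closure of explicit precedence, and the rotation poset is the set of rotations ordered by precedence. *)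

(* Defs.v *)
(* MathComp world, with real numbers taken from MathComp-Analysis. *)
From mathcomp Require Import all_boot all_order all_algebra all_fingroup.
From mathcomp Require Import reals.
From Stdlib Require Import Relation_Operators.

Set Implicit Arguments.
Unset Strict Implicit.
Unset Printing Implicit Defensive.

Import Order.TTheory GRing.Theory Num.Theory.

Local Open Scope ring_scope.

Definition strict_list (T : eqType) (p : rel T) : Prop :=
  [/\ irreflexive p, transitive p & forall x y, x != y -> p x y || p y x].

(* Men and women are both indexed by 'I_n.  [mprefers m w w'] means that man
   [m] strictly prefers [w] to [w'], i.e. [w] is strictly above [w'] on his
   list; [wprefers w m m'] is the same for woman [w]. *)
Record sm_instance (n : nat) := SMInstance {
  mprefers : 'I_n -> rel 'I_n;
  wprefers : 'I_n -> rel 'I_n;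
  mprefersP : forall m, strict_list (mprefers m);
  wprefersP : forall w, strict_list (wprefers w)
}.

(* [mhat], [mbar] are the preference and position of the men; [what], [wbar]
   those of the women. *)
Definition one_attribute (R : realType) (n : nat) (I : sm_instance n) : Prop :=
  exists mhat mbar what wbar : 'I_n -> R,
    [/\ forall m, injective (fun w => mhat m * wbar w),
        forall w, injective (fun m => what w * mbar m),
        forall m w w', mprefers I m w w' = (mhat m * wbar w > mhat m * wbar w')
      & forall w m m', wprefers I w m m' = (what w * mbar m > what w * mbar m')].

Section Rotations.
Variables (n : nat) (I : sm_instance n).

(* A matching is a permutation [mu]: the partner of man [m] is [mu m], and the
   partner of woman [w] is [mu^-1 w]. *)
Implicit Types (mu : {perm 'I_n}) (r : seq ('I_n * 'I_n)).

Definition blocking_pair mu (m w : 'I_n) : bool :=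
  [&& mu m != w, mprefers I m w (mu m) & wprefers I w m ((mu^-1)%g w)].

Definition stable mu : Prop := forall m w, ~~ blocking_pair mu m w.

Definition suitor_candidate mu (m w : 'I_n) : bool :=
  mprefers I m (mu m) w && wprefers I w m ((mu^-1)%g w).

(* [w] is the suitor of [m], which need not exist. *)
Definition is_suitor mu (m w : 'I_n) : bool :=
  suitor_candidate mu m w &&
  [forall w', suitor_candidate mu m w' ==> (w' == w) || mprefers I m w w'].

(* [path.cycle] also relates the last pair to the first; it is qualified because
   fingroup shadows [cycle]. *)
Definition exposed mu r : Prop :=
  [/\ r <> [::], uniq r, {in r, forall p, mu p.1 = p.2}
    & path.cycle (fun p q => is_suitor mu p.1 q.2) r].

Definition is_rotation r : Prop := exists2 mu, stable mu & exposed mu r.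

(* Rotations are cyclically ordered: a list represents its rotation only up to
   a cyclic shift. *)
Definition same_rotation r1 r2 : Prop := exists i, r2 = rot i r1.

Definition moves_man r (m w w' : 'I_n) : Prop :=
  exists2 p, p \in r & [/\ p.1 = m, p.2 = w & (next r p).2 = w'].

Definition moves_woman r (w m m' : 'I_n) : Prop :=
  exists2 p, p \in r & [/\ (next r p).2 = w, (next r p).1 = m & p.1 = m'].

Definition eliminates r (m w : 'I_n) : Prop :=
  exists m1 m2, [/\ moves_woman r w m1 m2,
                    m1 = m \/ wprefers I w m m1 & wprefers I w m2 m].

Definition explicitly_precedes r1 r2 : Prop :=
  exists m w w0 w',
    [/\ eliminates r1 m w, moves_man r2 m w0 w' & mprefers I m w w'].

(* Every link of a chain witnessing precedence is a rotation of [I]. *)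
Definition precedes : seq ('I_n * 'I_n) -> seq ('I_n * 'I_n) -> Prop :=
  clos_trans _ (fun r1 r2 =>
    [/\ is_rotation r1, is_rotation r2 & explicitly_precedes r1 r2]).

End Rotations.

(* Main.v *)
(* The sign of a preference value sorts each sex into two types: people of the
   same type have the same list, people of opposite types have reversed lists.
   If a stable matching contains (m,w), it matches the men of the type of m
   that w weakly prefers to m with the women of the type of w that m weakly
   prefers to w. Hence m and w have the same rank on these restricted lists,
   so a man has at most one stable partner of each type, and a rotation is a
   2-cycle on x, y, u, v, with x, y (and u, v) of opposite types, exchanging
   (x,v), (y,u) with (x,u), (y,v), in one of the two directions.
   For two rotations (x,y,u,v) and (x',y',u',v'), equality of ranks makes the
   comparisons of x with x', y with y', u with u' and v with v' all determine
   each other. This excludes opposite directions, and the rotation whose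
   interval between x and y is the larger one explicitly precedes the other. *)
Require Import Defs.
From mathcomp Require Import all_boot all_order all_algebra all_fingroup.
From mathcomp Require Import reals lra zify.
From Stdlib Require Import Relation_Operators.

Set Implicit Arguments.
Unset Strict Implicit.
Unset Printing Implicit Defensive.

Import Order.TTheory GRing.Theory Num.Theory.

Local Open Scope ring_scope.

(** * Elimination of an exposed rotation *)

Section Elimination.
Variables (n : nat) (I : sm_instance n).
Implicit Types (mu : {perm 'I_n}) (r : seq ('I_n * 'I_n)).

Lemma stableP mu :
  stable I mu <-> (forall m m', mprefers I m (mu m') (mu m) ->
                    wprefers I (mu m') m m' -> False).
Proof.
split=> [st m m' pm pw | H m w]; last first.
  apply/negP => /and3P[_ pm pw].
  by apply: (H m ((mu^-1)%g w)); rewrite permKV.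
have /negP := st m (mu m'); apply; rewrite /blocking_pair permK pm pw !andbT.
by apply: contraTneq pm => ->; have [irr _ _] := mprefersP I m; rewrite irr.
Qed.

Lemma exposed_next mu r p : exposed I mu r -> p \in r ->
  is_suitor I mu p.1 (next r p).2.
Proof. by move=> [_ _ _ cyc] pr; have := next_cycle cyc pr. Qed.

(** Used to make both ends of every move stable pairs. Women only gain, so the man of a new blocking
    pair must have been moved, and his suitor was the first woman willing to take him. *)
Lemma eliminate_rotation mu r : stable I mu -> exposed I mu r ->
  exists2 mu', stable I mu' & {in r, forall p, mu' p.1 = (next r p).2}.
Proof.
move=> st ex; have [_ ur muE _] := ex.
pose f m := if (m, mu m) \in r then (next r (m, mu m)).2 else mu m.
have pairE p : p \in r -> (p.1, mu p.1) = p.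
  by move=> pr; rewrite muE //; case: p {pr}.
have fE p : p \in r -> f p.1 = (next r p).2.
  by move=> pr; rewrite /f pairE ?pr.
have nextE p : p \in r -> (next r p).2 = mu (next r p).1.
  by move=> pr; rewrite muE // mem_next.
have f_inj : injective f.
  move=> m m'; rewrite /f; case: ifP => mr; case: ifP => mr'.
  - rewrite !nextE // => /perm_inj e.
    have e2 : next r (m, mu m) = next r (m', mu m').
      by rewrite -(pairE (next r (m, mu m))) ?mem_next // e pairE ?mem_next.
    by have := congr1 (prev r) e2; rewrite !prev_next // => -[].
  - rewrite nextE // => /perm_inj e.
    by rewrite -e pairE ?mem_next ?mr in mr'.
  - rewrite [RHS]nextE // => /perm_inj e.
    by rewrite e pairE ?mem_next ?mr' in mr.
  - exact: perm_inj.
exists (perm f_inj); last by move=> p pr; rewrite permE fE.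
apply/stableP => m m0; rewrite !permE.
have [irr tr tot] := mprefersP I m.
set w := f m0 => pm pw; have [wirr wtr _] := wprefersP I w.
have pw1 : wprefers I w m ((mu^-1)%g w).
  rewrite /w /f in pw wtr *; case: ifP pw wtr => [m0r|_] pw wtr.
    apply: wtr pw _.
    by have /andP[/andP[]] := exposed_next ex m0r.
  by rewrite permK.
have np : ~ mprefers I m w (mu m).
  move=> H; move/stableP: st => /(_ m ((mu^-1)%g w)).
  by rewrite permKV; apply.
have nw : mu m != w.
  by apply/eqP => e; move: pw1; rewrite -e permK e wirr.
have pmw : mprefers I m (mu m) w by case/orP: (tot _ _ nw).
rewrite {1}/f in pm; case: ifP pm => [mr|_] pm; last by apply: np.
(* Here [w] is a suitor candidate of [m], so she is his suitor, now his partner, or comes below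
   her. *)
have /andP[_ /forallP/(_ w)] := exposed_next ex mr.
rewrite /suitor_candidate pmw pw1 /= => /orP[/eqP e|h].
  by rewrite -e irr in pm.
by have := tr _ _ _ h pm; rewrite irr.
Qed.

End Elimination.

(** * Ranks within the classes of a two-valued type *)

Section Rank.
Variables (R : realDomainType) (T : finType) (f : T -> R) (t : T -> bool).
Hypothesis f_inj : injective f.

Definition class a := [set b | t b == t a].

(** The flag [s] is the direction of the list: for [true], large values of [f] come first. The best
    element has rank 1. *)
Definition rank (s : bool) a :=
  #|[set b | (t b == t a) && if s then f a <= f b else f b <= f a]|.

(** Counting from both ends covers the class and counts only [a] twice. *)
Lemma rankD s a : (rank s a + rank (~~ s) a = #|class a|.+1)%N.
Proof.
wlog -> : s / s.
  by case: s => [|H]; [apply | rewrite addnC; have := H true; apply].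
rewrite /rank -cardsUI addnC -add1n; congr (_ + _)%N.
  rewrite -(cards1 a); apply: eq_card => b; rewrite !inE.
  apply/andP/eqP => [[/andP[_ ab] /andP[_ ba]]|->]; last by rewrite eqxx lexx.
  by apply/f_inj/eqP; rewrite eq_le ba.
by apply: eq_card => b; rewrite !inE -andb_orr le_total andbT.
Qed.

Lemma rank_lt s a b : t a = t b ->
  (if s then f a < f b else f b < f a) -> (rank s b < rank s a)%N.
Proof.
move=> tab ab; apply/proper_card/properP; split.
  apply/subsetP => c; rewrite !inE tab; case/andP=> -> /=.
  by case: s ab => ab ?; lra.
exists a; rewrite !inE tab eqxx /=; first by case: (s).
by case: s ab => ab; rewrite -ltNge.
Qed.

Lemma rank_ltE s a b : t a = t b ->
  (rank s b < rank s a)%N = if s then f a < f b else f b < f a.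
Proof.
move=> tab; apply/idP/idP; last exact: rank_lt.
apply: contraTT => nab; rewrite -leqNgt leq_eqVlt.
have [-> | ne] := eqVneq a b; first by rewrite eqxx.
apply/orP; right; apply: rank_lt => //.
have : f a != f b by apply: contra ne => /eqP/f_inj ->.
by case: s nab; rewrite -leNgt neq_lt => ?; case/orP => ?; lra.
Qed.

Lemma rank_inj s a b : t a = t b -> rank s a = rank s b -> a = b.
Proof.
move=> tab rab; apply: f_inj; apply/eqP.
have := rank_ltE s tab; have := rank_ltE s (esym tab).
rewrite rab ltnn eq_le !leNgt.
by case: s {rab} => <- <-.
Qed.

Lemma card_class2 a b : t a != t b -> (#|class a| + #|class b| = #|T|)%N.
Proof.
move=> tab; rewrite -(cardsC (class a)); congr (_ + _)%N.
by apply: eq_card => c; rewrite !inE; case: (t a) (t b) (t c) tab => [] [] [].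
Qed.

End Rank.

(** * Stable pairs and rotations with two types in each sex *)

Section TwoTypes.
Variables (R : realDomainType) (n : nat) (I : sm_instance n).
Variables (mbar wbar : 'I_n -> R) (tm tw : 'I_n -> bool).
Hypotheses (mbar_inj : injective mbar) (wbar_inj : injective wbar).
Hypothesis mprefersE : forall m w w',
  mprefers I m w w' = if tm m then wbar w' < wbar w else wbar w < wbar w'.
Hypothesis wprefersE : forall w m m',
  wprefers I w m m' = if tw w then mbar m' < mbar m else mbar m < mbar m'.

Definition stable_pair m w := exists2 mu, stable I mu & mu m = w.

Notation rkm := (rank mbar tm).
Notation rkw := (rank wbar tw).

(* If a man m' of m's type is preferred by w but mu m' has the type opposite to
   w's, then (m, mu m') blocks mu: w prefers m', so mu m' prefers m, and m'
   prefers mu m' to w, so m does too. *)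
Lemma stable_pair_rank m w : stable_pair m w -> rkm (tw w) m = rkw (tm m) w.
Proof.
move=> [mu /stableP st <-{w}].
rewrite /rank -(card_imset _ (@perm_inj _ mu)); apply: eq_card => w.
rewrite -(permKV mu w); set m' := (mu^-1)%g w.
rewrite (mem_imset _ _ (@perm_inj _ mu)) !inE.
have [-> | ne] := eqVneq m' m; first by rewrite !eqxx; do 2!case: ifP; rewrite !lexx.
have nm : mbar m' != mbar m by apply: contra ne => /eqP/mbar_inj ->.
have nw : wbar (mu m') != wbar (mu m).
  by apply: contra ne => /eqP/wbar_inj/perm_inj ->.
have := st m m'; have := st m' m; rewrite !mprefersE !wprefersE.
move: nm nw; rewrite !neq_lt.
case: (tm m') (tm m) (tw (mu m')) (tw (mu m)) => [] [] [] [] /=;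
 case: (ltgtP (mbar m') (mbar m)) => // _ _;
 case: (ltgtP (wbar (mu m')) (wbar (mu m))) => // _ _ H1 H2;
 by [ | case: H1 | case: H2].
Qed.

Lemma rotation_next r p (q := next r p) : is_rotation I r -> p \in r ->
  [/\ q \in r, mprefers I p.1 p.2 q.2, wprefers I q.2 p.1 q.1,
      stable_pair p.1 p.2 & stable_pair p.1 q.2].
Proof.
move=> [mu st ex] pr; have [_ ur muE _] := ex.
have qr : q \in r by rewrite mem_next.
have /andP[/andP[pm pw] _] := exposed_next ex pr.
rewrite -/q -(muE q qr) permK in pw; rewrite muE // in pm.
split=> //.
- by rewrite -(muE q qr).
- by exists mu => //; apply: muE.
- by have [mu' st' H] := eliminate_rotation st ex; exists mu' => //; apply: H.
Qed.

Lemma stable_pair_inj m m' w w' : stable_pair m w -> stable_pair m' w' ->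
  tm m = tm m' -> tw w = tw w' -> (m == m') = (w == w').
Proof.
move=> /stable_pair_rank mw /stable_pair_rank mw' tmm tww.
rewrite -tmm -tww in mw'.
apply/eqP/eqP => e.
  by apply: (rank_inj wbar_inj (s := tm m) tww); rewrite -mw -mw' e.
by apply: (rank_inj mbar_inj (s := tw w) tmm); rewrite mw mw' e.
Qed.

Lemma stable_pair_lt m m' w w' : stable_pair m w -> stable_pair m' w' ->
  tm m = tm m' -> tw w = tw w' ->
  (if tw w then mbar m < mbar m' else mbar m' < mbar m) =
  (if tm m then wbar w < wbar w' else wbar w' < wbar w).
Proof.
move=> /stable_pair_rank mw /stable_pair_rank mw' tmm tww.
rewrite -tmm -tww in mw'.
by rewrite -(rank_ltE mbar_inj (tw w) tmm) mw mw' rank_ltE.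
Qed.

(** If a type were repeated, [stable_pair_inj] would identify the two women paired with [p.1], or
    the two men paired with [q.2], against a strict preference. *)
Lemma rotation_types r p (q := next r p) : is_rotation I r -> p \in r ->
  tm q.1 = ~~ tm p.1 /\ tw q.2 = ~~ tw p.2.
Proof.
move=> hr pr; have [qr pm pw sp spq] := rotation_next hr pr.
have [_ _ _ sq _] := rotation_next hr qr.
have [mirr _ _] := mprefersP I p.1; have [wirr _ _] := wprefersP I q.2.
have neqE (a b : bool) : a <> b -> a = ~~ b by case: a b => [] [].
split; apply: neqE => e.
  have := stable_pair_inj spq sq (esym e) erefl.
  by rewrite eqxx => /eqP e1; rewrite e1 wirr in pw.
have := stable_pair_inj sp spq erefl (esym e).
by rewrite eqxx => /esym/eqP e1; rewrite e1 mirr in pm.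
Qed.

Lemma rotation_2cycle r p : is_rotation I r -> p \in r ->
  next r (next r p) = p.
Proof.
move=> hr pr; set q := next r p; set p2 := next r q.
have [qr _ _ sp spq] := rotation_next hr pr.
have [p2r _ _ sq sqp2] := rotation_next hr qr.
have [_ _ _ sp2 _] := rotation_next hr p2r.
have [tmq twq] := rotation_types hr pr; rewrite -/q in tmq twq.
have [tmp2 twp2] := rotation_types hr qr; rewrite -/p2 in tmp2 twp2.
rewrite tmq negbK in tmp2; rewrite twq negbK in twp2.
(* Summing [rankD] over both types of men and both types of women forces p2.2
   and p.2 to have the same rank. *)
have e2 : p2.2 = p.2.
  apply: (rank_inj wbar_inj (s := ~~ tm p.1) twp2).
  have := stable_pair_rank sqp2; have := stable_pair_rank sq.
  have := stable_pair_rank sp; have := stable_pair_rank spq.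
  rewrite -/q -/p2 twp2 tmq twq.
  have := rankD tm mbar_inj (tw p.2) p.1.
  have := rankD tm mbar_inj (tw p.2) q.1.
  have := rankD tw wbar_inj (tm p.1) p.2.
  have := rankD tw wbar_inj (tm p.1) q.2.
  have := @card_class2 _ tm p.1 q.1; have := @card_class2 _ tw p.2 q.2.
  rewrite tmq twq; case: (tm p.1) (tw p.2) => [] [] /=; lia.
have e1 : p2.1 = p.1.
  by apply/eqP; rewrite (stable_pair_inj sp2 sp tmp2 twp2); apply/eqP.
by rewrite (surjective_pairing p2) e1 e2 -surjective_pairing.
Qed.

(** Up to a shift, both lists are [p] followed by its successor. *)
Lemma same_rotation_common r r' p : is_rotation I r -> is_rotation I r' ->
  p \in r -> p \in r' -> next r p = next r' p -> same_rotation r r'.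
Proof.
have rotE s : is_rotation I s -> p \in s -> exists i, rot i s = [:: p; next s p].
  move=> hs ps; have [mu _ [_ us _ _]] := hs.
  have [i s' e] := rot_to ps; exists i.
  have := rotation_2cycle hs ps.
  have [_ pm _ _ _] := rotation_next hs ps.
  have nepq : next s p != p.
    apply: contraTneq pm => ->.
    by have [irr _ _] := mprefersP I p.1; rewrite irr.
  rewrite -!(next_rot i us) e; move: nepq; rewrite -(next_rot i us) e.
  have : uniq (p :: s') by rewrite -e rot_uniq.
  case: s' {e} => [|q [|q' s']] /=; rewrite ?eqxx //.
  rewrite !inE !negb_or => /and4P[/and3P[pq pq' _] _ _ _] _.
  rewrite eq_sym (negbTE pq) => e.
  by rewrite e eqxx in pq'.
move=> hr hr' pr pr' e; have [i ri] := rotE r hr pr; have [j rj] := rotE r' hr' pr'.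
rewrite -e -ri in rj.
have -> : r' = rotr j (rot i r) by rewrite -rj rotK.
(* Capping [i] at the size lets [rot_add_mod] merge the two shifts into one. *)
rewrite /same_rotation /rotr (rot_minn i) size_rot.
rewrite rot_add_mod ?geq_minr ?leq_subr //; exact: ex_intro.
Qed.

(** * Rotations as quadruples, and their comparison *)

Definition quad x y u v :=
  [/\ tm x, ~~ tm y, tw u & ~~ tw v] /\
  [/\ stable_pair x u, stable_pair x v & stable_pair y u].

(** The comparison passes along the stable pairs from [x] to [u] and [v], and from [u] to [y]; a
    pair of unequal types reverses it. *)
Lemma quad_lt x y u v x' y' u' v' : quad x y u v -> quad x' y' u' v' ->
  [/\ (mbar x < mbar x') = (wbar u < wbar u'),
      (mbar x < mbar x') = (wbar v' < wbar v)
    & (mbar x < mbar x') = (mbar y' < mbar y)].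
Proof.
move=> [[tx ty tu tv] [xu xv yu]] [[tx' ty' tu' tv'] [xu' xv' yu']].
have := stable_pair_lt yu' yu; have := stable_pair_lt xv' xv.
have := stable_pair_lt xu xu'.
rewrite tx tx' tu tu' (negbTE ty) (negbTE ty') (negbTE tv) (negbTE tv').
by move=> -> // -> // ->.
Qed.

Lemma quad_eq x y u v y' u' v' : quad x y u v -> quad x y' u' v' ->
  [/\ y = y', u = u' & v = v'].
Proof.
move=> [[tx ty tu tv] [xu xv yu]] [[_ ty' tu' tv'] [xu' xv' yu']].
have eu : u = u'.
  by apply/eqP; rewrite -(stable_pair_inj xu xu') ?tu ?tu'.
split=> //.
  by apply/eqP; rewrite (stable_pair_inj yu yu') ?eu // (negbTE ty) (negbTE ty').
by apply/eqP; rewrite -(stable_pair_inj xv xv') // (negbTE tv) (negbTE tv').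
Qed.

(* An up rotation turns the pairs (x,v), (y,u) into (x,u), (y,v); a down
   rotation does the reverse. *)
Definition up_rotation r x y u v :=
  quad x y u v /\
  [/\ mbar y < mbar x, wbar u < wbar v, (x, v) \in r & next r (x, v) = (y, u)].

Definition down_rotation r x y u v :=
  quad x y u v /\
  [/\ mbar x < mbar y, wbar v < wbar u, (x, u) \in r & next r (x, u) = (y, v)].

Lemma rotation_up_or_down r : is_rotation I r -> exists x y u v,
  up_rotation r x y u v \/ down_rotation r x y u v.
Proof.
move=> hr.
have [p pr tp] : exists2 p, p \in r & tm p.1.
  have [mu _ [r0 _ _ _]] := hr.
  have [p0 p0r] : exists p0, p0 \in r.
    by case: (r) r0 => [//|p0 ? _]; exists p0; rewrite mem_head.
  case tp: (tm p0.1); first by exists p0.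
  exists (next r p0); first by rewrite mem_next.
  by have [-> _] := rotation_types hr p0r; rewrite tp.
have [qr pm pw sp spq] := rotation_next hr pr.
have [_ _ _ sq] := rotation_next hr qr; rewrite (rotation_2cycle hr pr) => sqp.
have [tq twq] := rotation_types hr pr.
move: pm pw; rewrite mprefersE wprefersE tp twq => pm pw.
exists p.1, (next r p).1.
case twp: (tw p.2) pw => /= pw.
  exists p.2, (next r p).2; right; split; rewrite -?surjective_pairing //.
  by split=> //; rewrite ?tq ?twq ?tp ?twp.
exists (next r p).2, p.2; left; split; rewrite -?surjective_pairing //.
by split=> //; rewrite ?tq ?twq ?tp ?twp.
Qed.

(** By [mbar], y < y' < x' < x. Moving [u] from [y] to [x] passes over [x'] and eliminates (x', u),
    while [r'] moves [x'] to [u'], who is below [u]. *)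
Lemma up_precedes r r' x y u v x' y' u' v' :
  up_rotation r x y u v -> up_rotation r' x' y' u' v' -> mbar x' < mbar x ->
  explicitly_precedes I r r'.
Proof.
move=> [q [yx uv xr nr]] [q' [yx' uv' xr' nr']] lt_x.
have [] := quad_lt q' q; rewrite lt_x => lt_u _ lt_y.
have [[tx' _ _ _] _] := q'; have [[_ _ tu _] _] := q.
exists x', u, v', u'; split; last by rewrite mprefersE tx' -lt_u.
- exists y, x; split; first by exists (x, v) => //; rewrite nr.
    by right; rewrite wprefersE tu; apply: lt_trans yx'.
  by rewrite wprefersE tu.
- by exists (x', v') => //; rewrite nr'.
Qed.

(** Now x < x' < y' < y, and [u] passes over [x'] on her way from [x] to [y]; by [wbar], v' < v <
    u. *)
Lemma down_precedes r r' x y u v x' y' u' v' : is_rotation I r ->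
  down_rotation r x y u v -> down_rotation r' x' y' u' v' -> mbar x < mbar x' ->
  explicitly_precedes I r r'.
Proof.
move=> hr [q [xy vu xr nr]] [q' [xy' vu' xr' nr']] lt_x.
have [] := quad_lt q q'; rewrite lt_x => _ lt_v lt_y.
have [[tx' _ _ _] _] := q'; have [[_ _ tu _] _] := q.
have nyr := rotation_2cycle hr xr; rewrite nr in nyr.
exists x', u, u', v'; split.
- exists x, y; split.
  + by exists (y, v); rewrite ?nyr // -nr mem_next.
  + by right; rewrite wprefersE tu.
  + by rewrite wprefersE tu; apply: lt_trans xy' _.
- by exists (x', u') => //; rewrite nr'.
- by rewrite mprefersE tx'; apply: lt_trans vu.
Qed.

(** If x < x', the men give the cycle y < x < x' < y' < y; if x' < x, the women give u < v < v' < u'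
    < u. *)
Lemma not_up_and_down r r' x y u v x' y' u' v' :
  up_rotation r x y u v -> ~ down_rotation r' x' y' u' v'.
Proof.
move=> [q [yx uv _ _]] [q' [xy' vu' _ _]].
have [e1 e2 e3] := quad_lt q q'; have [e4 e5 _] := quad_lt q' q.
case: (ltgtP (mbar x) (mbar x')) e1 e2 e3 e4 e5; last 1 first.
- move=> /mbar_inj e; rewrite -e in q' xy'.
  have [ey _ _] := quad_eq q q'.
  by rewrite -ey in xy'; have := lt_trans xy' yx; rewrite ltxx.
- move=> lt_x _ _ /esym lt_y _ _.
  by have := lt_trans (lt_trans yx lt_x) (lt_trans xy' lt_y); rewrite ltxx.
- move=> lt_x _ _ _ /esym lt_u /esym lt_v.
  by have := lt_trans (lt_trans uv lt_v) (lt_trans vu' lt_u); rewrite ltxx.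
Qed.

Lemma rotations_chain r r' : is_rotation I r -> is_rotation I r' ->
  ~ same_rotation r r' ->
  explicitly_precedes I r r' \/ explicitly_precedes I r' r.
Proof.
move=> hr hr' hne.
have [x [y [u [v ud]]]] := rotation_up_or_down hr.
have [x' [y' [u' [v' ud']]]] := rotation_up_or_down hr'.
case: ud ud' => [H|H] [H'|H'].
- have [lt_x|lt_x|/mbar_inj e] := ltgtP (mbar x) (mbar x').
  + by right; apply: up_precedes H' H lt_x.
  + by left; apply: up_precedes H H' lt_x.
  case: H H' => [q [_ _ xr nr]] [q' [_ _ xr' nr']]; case: hne.
  rewrite -e in q' xr' nr'; have [ey eu ev] := quad_eq q q'.
  rewrite -ey -eu -ev in xr' nr'.
  by apply: (same_rotation_common hr hr' xr xr'); rewrite nr'.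
- by have := not_up_and_down H H'.
- by have := not_up_and_down H' H.
- have [lt_x|lt_x|/mbar_inj e] := ltgtP (mbar x) (mbar x').
  + by left; apply: down_precedes H H' lt_x.
  + by right; apply: down_precedes H' H lt_x.
  case: H H' => [q [_ _ xr nr]] [q' [_ _ xr' nr']]; case: hne.
  rewrite -e in q' xr' nr'; have [ey eu ev] := quad_eq q q'.
  rewrite -ey -eu -ev in xr' nr'.
  by apply: (same_rotation_common hr hr' xr xr'); rewrite nr'.
Qed.

End TwoTypes.

Theorem theorem22 (R : realType) (n : nat) (I : sm_instance n)
    (hI : one_attribute R I) (r r' : seq ('I_n * 'I_n))
    (hr : is_rotation I r) (hr' : is_rotation I r')
    (hne : ~ same_rotation r r') :
  precedes I r r' \/ precedes I r' r.
Proof.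
have [mhat [mbar [what [wbar [minj winj mE wE]]]]] := hI.
have signE (a b c : R) : (b <> c -> a <> 0) ->
    (a * b < a * c) = if 0 < a then b < c else c < b.
  move=> a0; have [a_gt0|a_lt0|a_eq0] := ltgtP 0 a.
  - by rewrite ltr_pM2l.
  - by rewrite ltr_nM2l.
  (* A zero preference value is possible when there is just one person to rank; both sides are then
     false. *)
  - have [->|/eqP ne] := eqVneq b c; first by rewrite !ltxx.
    by case: (a0 ne).
have wbar_inj : injective wbar by move=> w w' e; apply: (minj w); rewrite /= e.
have mbar_inj : injective mbar by move=> m m' e; apply: (winj m); rewrite /= e.
have mE' m w w' : mprefers I m w w' =
    if 0 < mhat m then wbar w' < wbar w else wbar w < wbar w'.
  rewrite mE signE // => ne m0; apply: ne; congr wbar.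
  by apply: (minj m); rewrite /= m0 !mul0r.
have wE' w m m' : wprefers I w m m' =
    if 0 < what w then mbar m' < mbar m else mbar m < mbar m'.
  rewrite wE signE // => ne w0; apply: ne; congr mbar.
  by apply: (winj w); rewrite /= w0 !mul0r.
have [H|H] := rotations_chain mbar_inj wbar_inj mE' wE' hr hr' hne.
  by left; apply: t_step.
by right; apply: t_step.
Qed.
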